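(* Let $\mathbf{A}$ and $\mathbf{B}$ be two conservative median algebras with at least five elements. A map $f\colon\mathbf{A}\to\mathbf{B}$ is a median homomorphism if and only if it is monotone with respect to the chain orderings of $\mathbf{A}$ and $\mathbf{B}$.
   Context: A median algebra is a set $A$ with a ternary operation $\mathbf{m}$ satisfying $\mathbf{m}(x,x,y)=x$; $\mathbf{m}(x,y,z)=\mathbf{m}(y,x,z)=\mathbf{m}(y,z,x)$; and $\mathbf{m}(\mathbf{m}(x,y,z),t,u)=\mathbf{m}(x,\mathbf{m}(y,t,u),\mathbf{m}(z,t,u))$. It is conservative if $\mathbf{m}(x,y,z)\in\{x,y,z\}$ for all $x,y,z\in A$. A median homomorphism is a map $f$ with $f(\mathbf{m}(x,y,z))=\mathbf{m}(f(x),f(y),f(z))$ for all $x,y,z$. For a total order $\leq$, its median operation is $\mathbf{m}_\leq(x,y,z)=(x\wedge y)\vee(x\wedge z)\vee(z\wedge y)$, with $\wedge,\vee$ minimum and maximum. For a conservative median algebra $\mathbf{A}=\langle A,\mathbf{m}\rangle$ with $|A|\geq 5$ there is a total order $\leq_{\mathbf{A}}$ on $A$ with $\mathbf{m}=\mathbf{m}_{\leq_{\mathbf{A}}}$, and $\langle A,\leq_{\mathbf{A}}\rangle$ is unique up to isomorphism and dual isomorphism; $\leq_{\mathbf{A}}$ is called the chain ordering of $\mathbf{A}$. A map between posets is monotone if it is isotone (order-preserving) or antitone (order-reversing). *)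

(* Defs.v *)
From HB Require Import structures.
From mathcomp Require Import all_boot.
From mathcomp Require Import boolp.

Set Implicit Arguments.
Unset Strict Implicit.
Unset Printing Implicit Defensive.

HB.mixin Record isMedianAlgebra A := {
  med : A -> A -> A -> A;
  medxx : forall x y, med x x y = x;
  medC12 : forall x y z, med x y z = med y x z;
  medC23 : forall x y z, med y x z = med y z x;
  med_distr : forall x y z t u,
    med (med x y z) t u = med x (med y t u) (med z t u)
}.

#[short(type="medianAlgebraType")]
HB.structure Definition MedianAlgebra := { A of isMedianAlgebra A }.

Definition conservative (A : medianAlgebraType) :=
  forall x y z : A, [\/ med x y z = x, med x y z = y | med x y z = z].

Definition at_least_five (A : Type) := exists g : 'I_5 -> A, injective g.

Definition median_hom (A B : medianAlgebraType) (f : A -> B) :=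
  forall x y z, f (med x y z) = med (f x) (f y) (f z).

Definition total_order (A : Type) (le : rel A) :=
  [/\ reflexive le, antisymmetric le, transitive le & total le].

Definition minimum (A : Type) (le : rel A) x y := if le x y then x else y.
Definition maximum (A : Type) (le : rel A) x y := if le x y then y else x.

Definition order_median (A : Type) (le : rel A) (x y z : A) :=
  maximum le (maximum le (minimum le x y) (minimum le x z)) (minimum le z y).

(* The median operation determines such an order only up to reversal, hence a
   predicate; existence is [chain_ordering_exists] below. *)
Definition chain_ordering (A : medianAlgebraType) (le : rel A) :=
  total_order le /\ forall x y z : A, med x y z = order_median le x y z.

Definition isotone (A B : Type) (leA : rel A) (leB : rel B) (f : A -> B) :=
  {homo f : x y / leA x y >-> leB x y}.

Definition antitone (A B : Type) (leA : rel A) (leB : rel B) (f : A -> B) :=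
  {homo f : x y / leA x y >-> leB y x}.

Definition monotone (A B : Type) (leA : rel A) (leB : rel B) (f : A -> B) :=
  isotone leA leB f \/ antitone leA leB f.

Definition btw (A : medianAlgebraType) (x y z : A) := med x y z = y.

Lemma btwC (A : medianAlgebraType) (x y z : A) : btw x y z -> btw z y x.
Proof. by rewrite /btw => h; rewrite medC12 medC23 medC12. Qed.

Lemma btwxx (A : medianAlgebraType) (x y : A) : btw x x y.
Proof. exact: medxx. Qed.

Lemma btw_anti (A : medianAlgebraType) (x y z : A) :
  btw x y z -> btw x z y -> y = z.
Proof. by rewrite /btw => h1 h2; rewrite -h1 medC23. Qed.

Lemma btw_id (A : medianAlgebraType) (x y : A) : btw x y x -> x = y.
Proof. by rewrite /btw medC23 medxx. Qed.

Lemma btw_trans (A : medianAlgebraType) (a b c d : A) :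
  btw a b c -> btw a c d -> btw a b d.
Proof.
rewrite /btw => h1 h2; rewrite medC12 -{1}h1 (medC12 a b c) med_distr medxx.
by rewrite (medC12 c) h2 medC12.
Qed.

Lemma btw_trans2 (A : medianAlgebraType) (a b c d : A) :
  btw a b c -> btw a c d -> btw b c d.
Proof.
rewrite /btw => h1 h2; rewrite -{1}h1 (medC12 a b c) med_distr medxx h2.
by rewrite medC12 medC23 medxx.
Qed.

Lemma btw_cases (A : medianAlgebraType) (x y z : A) : conservative A ->
  [\/ btw y x z, btw x y z | btw x z y].
Proof.
move=> /(_ x y z) [] h; rewrite /btw.
- by apply: Or31; rewrite medC12.
- by apply: Or32.
- by apply: Or33; rewrite medC23.
Qed.

Definition square (A : medianAlgebraType) (a b c d : A) :=
  [/\ btw a b c, btw b c d, btw c d a & btw d a b].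

Lemma square_rot (A : medianAlgebraType) (a b c d : A) :
  square a b c d -> square b c d a.
Proof. by case. Qed.

Lemma square_rev (A : medianAlgebraType) (a b c d : A) :
  square a b c d -> square a d c b.
Proof. by case=> *; split; exact: btwC. Qed.

Lemma square_side (A : medianAlgebraType) (a b c d e : A) :
  conservative A -> square a b c d -> e <> a -> e <> b -> e <> c -> e <> d ->
  btw a e c -> btw a e b \/ btw a e d.
Proof.
move=> cA [abc bcd cda dab] ea eb ec ed aec.
have E : med c (med b a e) (med d a e) = e.
  by rewrite -med_distr (medC12 c) bcd medC12 medC23.
have [hb|hb|hb] := cA b a e; last by left; rewrite /btw -medC23 medC12.
all: have [hd|hd|hd] := cA d a e; last by right; rewrite /btw -medC23 medC12.
all: move: E; rewrite hb hd.
- by rewrite medC12 bcd => /esym.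
- by rewrite (btwC abc) => /esym.
- by rewrite medC23 cda => /esym.
- by rewrite medC12 medC23 medxx => /esym.
Qed.

Lemma square_inner (A : medianAlgebraType) (a b c d e : A) :
  conservative A -> square a b c d -> e <> a -> e <> b -> e <> c -> e <> d ->
  a <> b -> a <> d -> ~ btw a e c.
Proof.
move=> cA.
have H (b' d' : A) : square a b' c d' -> e <> a -> e <> b' -> e <> c ->
    e <> d' -> a <> d' -> btw a e c -> btw a e b' -> False.
  move=> sq ea eb ec ed ad aec aeb; have [abc bcd cda dab] := sq.
  have sq' : square c b' a d' := square_rev (square_rot (square_rot sq)).
  have [ceb|ced] := square_side cA sq' ec eb ea ed (btwC aec).
    exact/eb/(btw_anti ceb)/btwC/(btw_trans2 aeb).
  apply: ad; apply: (@btw_anti _ e); last exact: btw_trans2 ced cda.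
  exact: btw_trans2 (btwC aeb) (btwC dab).
move=> sq ea eb ec ed ab ad aec.
have [aeb|aed] := square_side cA sq ea eb ec ed aec; first exact: (H b d).
by apply: (H d b) => //; apply: square_rev.
Qed.

Lemma square_false (A : medianAlgebraType) (a b c d e : A) :
  conservative A -> square a b c d -> e <> a -> e <> b -> e <> c -> e <> d ->
  a <> b -> b <> c -> c <> d -> d <> a -> False.
Proof.
move=> cA sq ea eb ec ed ab bc cd da.
have H (x y z t : A) : square x y z t -> x <> y -> btw e x z -> btw e y t ->
    False.
  move=> [xyz yzt ztx txy] xy exz eyt; apply/xy/(@btw_anti _ e); apply: btwC.
    exact: btw_trans2 (btwC xyz) (btwC exz).
  exact: btw_trans2 txy (btwC eyt).
have sq1 := square_rot sq; have sq2 := square_rot sq1.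
have sq3 := square_rot sq2.
have [eac|/(square_inner cA sq)|/btwC eca] := btw_cases a e c cA; last 2 first.
- by apply => //; exact: nesym.
- have [ebd|/(square_inner cA sq1)|/btwC edb] := btw_cases b e d cA.
  + exact: (H _ _ _ _ (square_rev sq2) (nesym bc) eca ebd).
  + by apply => //; exact: nesym.
  + exact: (H _ _ _ _ sq2 cd eca edb).
- have [ebd|/(square_inner cA sq1)|/btwC edb] := btw_cases b e d cA.
  + exact: (H _ _ _ _ sq ab eac ebd).
  + by apply => //; exact: nesym.
  + exact: (H _ _ _ _ (square_rev sq) (nesym da) eac edb).
Qed.

Lemma fifth_point (A : Type) (a b c d : A) :
  at_least_five A -> exists e, [/\ e <> a, e <> b, e <> c & e <> d].
Proof.
move=> [g gI]; apply: contrapT => N.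
pose h i : 'I_4 := if pselect (g i = a) then inord 0 else
  if pselect (g i = b) then inord 1 else
  if pselect (g i = c) then inord 2 else inord 3.
pose k (j : 'I_4) := nth d [:: a; b; c; d] j.
have hK i : k (h i) = g i.
  rewrite /k /h; case: pselect => [E|na]; first by rewrite inordK.
  case: pselect => [E|nb]; first by rewrite inordK.
  case: pselect => [E|nc]; first by rewrite inordK.
  rewrite inordK //=; apply: contrapT => nd; apply: N; exists (g i).
  by split=> //; exact: nesym.
suff /leq_card : injective h by rewrite !card_ord.
by move=> i j hij; apply: gI; rewrite -!hK hij.
Qed.

Lemma btw_outer (A : medianAlgebraType) (x p q z : A) :
  conservative A -> at_least_five A -> btw x p q -> btw p q z -> p <> q ->
  btw x p z.
Proof.
move=> cA A5 xpq pqz pq.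
have [pxz|//|xzp] := btw_cases x p z cA; last first.
  by case: pq; apply: (btw_anti xpq); apply: btwC; exact: btw_trans pqz (btwC xzp).
have [xp|xp] := pselect (x = p); first by rewrite xp; exact: btwxx.
have [zx|zx] := pselect (z = x).
  by case: pq; apply: (btw_anti xpq); apply: btwC; rewrite -zx.
have [qz|qz] := pselect (q = z); first by rewrite -qz.
have [zqx|qzx|qxz] := btw_cases q z x cA.
- exact: btw_trans xpq (btwC zqx).
- have [e [ep eq ez ex]] := fifth_point p q z x A5.
  by case: (square_false cA (And4 pqz qzx (btwC pxz) xpq) ep eq ez ex).
- by case: pq; apply: (btw_anti xpq); exact: btw_trans2 (btwC qxz) (btwC pqz).
Qed.

Lemma chain_ordering_exists (A : medianAlgebraType) :
  conservative A -> at_least_five A -> exists le : rel A, chain_ordering le.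
Proof.
move=> cA A5; have [g gI] := A5.
pose p := g ord0; pose q := g ord_max.
have pq : p <> q by move=> /gI.
pose N x := x <> p /\ btw x p q.
pose P x := x = p \/ ~ btw x p q.
have NP x : N x \/ P x.
  have [xp|xp] := pselect (x = p); first by right; left.
  by have [xpq|xpq] := pselect (btw x p q); [left | right; right].
have NPF x : N x -> P x -> False by move=> [? ?] [].
have Ppos x : P x -> btw p x q \/ btw p q x.
  move=> [-> |nx]; first by left; exact: btwxx.
  by have [|/nx|/btwC] := btw_cases x p q cA; [left| |right].
have sep x z : N x -> P z -> btw x p z.
  move=> [xp xpq] /Ppos [pzq|pqz]; last exact: btw_outer xpq pqz pq.
  by apply: btwC; exact: btw_trans2 (btwC pzq) (btwC xpq).
pose le x y : bool := `[< [\/ N x /\ P y, [/\ P x, P y & btw p x y] |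
  [/\ N x, N y & btw p y x]] >].
have le_btw x y z : le x y -> le y z -> btw x y z.
  move=> /asboolP[[Nx Py]|[Px Py pxy]|[Nx Ny pyx]].
  - move=> /asboolP[[/NPF]|[_ Pz pyz]|[/NPF]] //.
    by apply: btwC; exact: btw_trans (btwC pyz) (btwC (sep _ _ Nx Pz)).
  - move=> /asboolP[[/NPF]|[_ Pz pyz]|[/NPF]] //.
    exact: btw_trans2 pxy pyz.
  - move=> /asboolP[[_ Pz]|[/(NPF _ Ny)]|[_ Nz pzy]] //.
      exact: btw_trans (btwC pyx) (sep _ _ Nx Pz).
    by apply: btwC; exact: btw_trans2 pzy pyx.
have totP x y : P x -> P y -> btw p x y \/ btw p y x.
  move=> Px Py; have [pxy|xpy|/btwC] := btw_cases x p y cA; [by left| |by right].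
  have [pxq|pqx] := Ppos x Px; have [pyq|pqy] := Ppos y Py.
  - have [xp|xp] := pselect (x = p); first by left; rewrite xp; exact: btwxx.
    have [yp|yp] := pselect (y = p); first by right; rewrite yp; exact: btwxx.
    have [xq|xq] := pselect (x = q); first by right; rewrite xq.
    have [yq|yq] := pselect (y = q); first by left; rewrite yq.
    have [qxy|xqy|xyq] := btw_cases x q y cA.
    + by right; apply: btwC; exact: btw_trans2 qxy (btwC pyq).
    + have [e [ex eq ey ep]] := fifth_point x q y p A5.
      case: (square_false cA (And4 xqy (btwC pyq) (btwC xpy) pxq) ex eq ey ep);
        by [|exact: nesym].
    + by left; apply: btwC; exact: btw_trans2 (btwC xyq) (btwC pxq).
  - by left; exact: btw_trans pxq pqy.
  - by right; exact: btw_trans pyq pqx.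
  - case: pq; apply: (@btw_anti _ y _ _ _ (btwC pqy)); apply: btwC.
    exact: btw_trans2 (btwC pqx) xpy.
have totN x y : N x -> N y -> btw p x y \/ btw p y x.
  move=> [_ xpq] [_ ypq].
  have [yxq|xyq|xqy] := btw_cases x y q cA.
  - by left; exact: btw_trans2 (btwC xpq) (btwC yxq).
  - by right; exact: btw_trans2 (btwC ypq) (btwC xyq).
  - by case: pq; apply: (btw_anti ypq); apply: btwC; exact: btw_trans2 xpq xqy.
have tot : total le.
  move=> x y; apply/orP; have [Nx|Px] := NP x; have [Ny|Py] := NP y.
  - by have [h|h] := totN x y Nx Ny; [right|left]; apply/asboolP; apply: Or33.
  - by left; apply/asboolP; apply: Or31.
  - by right; apply/asboolP; apply: Or31.
  - by have [h|h] := totP x y Px Py; [left|right]; apply/asboolP; apply: Or32.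
have refl : reflexive le by move=> x; have := tot x x; rewrite orbb.
exists le; split.
  split=> //.
  - by move=> x y /andP[xy yx]; apply: btw_id; exact: le_btw xy yx.
  move=> y x z /asboolP[[Nx Py]|[Px Py pxy]|[Nx Ny pyx]].
  - move=> /asboolP[[/NPF]|[_ Pz pyz]|[/NPF]] //.
    by apply/asboolP; apply: Or31.
  - move=> /asboolP[[/NPF]|[_ Pz pyz]|[/NPF]] //.
    by apply/asboolP; apply: Or32; split=> //; exact: btw_trans pxy pyz.
  - move=> /asboolP[[_ Pz]|[/(NPF _ Ny)]|[_ Nz pzy]] //.
      by apply/asboolP; apply: Or31.
    by apply/asboolP; apply: Or33; split=> //; exact: btw_trans pzy pyx.
have W x y z : le x y -> le y z -> [/\ med x y z = y, med y x z = y,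
    med x z y = y, med z x y = y & med y z x = y /\ med z y x = y].
  move=> xy yz; have E : med x y z = y := le_btw _ _ _ xy yz.
  have E' : med z y x = y := btwC E.
  by split; [|rewrite medC12|rewrite medC23 E|rewrite medC23 E'|split=> //;
    rewrite medC12].
have leN u v : le u v = false -> le v u.
  by move=> uv; have := tot u v; rewrite uv.
move=> x y z; rewrite /order_median /maximum /minimum.
case xy: (le x y); case xz: (le x z); case zy: (le z y).
all: rewrite ?refl ?xz ?zy ?xy ?refl ?xz ?zy ?xy.
- by have [] := W _ _ _ xz zy.
- by have [] := W _ _ _ xy (leN _ _ zy).
- by have [? ? ? ? []] := W _ _ _ (leN _ _ xz) xy.
- by rewrite ?xy; have [] := W _ _ _ xy (leN _ _ zy).
- by rewrite (leN _ _ xy) xz; have [] := W _ _ _ xz zy.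
- by rewrite (leN _ _ xy) xy; have [? ? ? ? []] := W _ _ _ (leN _ _ xy) xz.
- case yz: (le y z); rewrite ?refl ?yz.
    by have [? ? ? ? []] := W _ _ _ yz (leN _ _ xz).
  by have [? ? ? ? []] := W _ _ _ zy (leN _ _ xy).
- rewrite (leN _ _ zy) zy.
  by have [? ? ? ? []] := W _ _ _ (leN _ _ zy) (leN _ _ xz).
Qed.

(* Main.v *)
Require Import Defs.
From mathcomp Require Import all_boot.
From mathcomp Require Import boolp.

Set Implicit Arguments.
Unset Strict Implicit.
Unset Printing Implicit Defensive.

(** Both properties of [f] say that [f] preserves betweenness.

    In a conservative algebra each value [med x y z] is one of [x], [y], [z],
    and to be that one is to lie between the other two; so a map defined on
    such an algebra is a median homomorphism as soon as it preserves the
    relation [btw] ([median_hom_btw]).  For a chain ordering, [btw] is betweenness in the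
    chain ([chain_btw]), and this relation does not see the direction of the
    order.

    What remains concerns total orders only.  A monotone map clearly preserves
    betweenness.  Conversely, when [f] preserves betweenness, the direction of
    [f] on an interval [[m, M]] is decided by the endpoints: if [f m] is below
    [f M], then [f] is isotone on the whole interval, and dually
    ([between_isotone_on]).  If [f] were neither isotone nor antitone, two
    pairs of points would witness this, and an interval containing all four
    points would give a contradiction. *)

Section Between.

Variable T : Type.

Definition between (le : rel T) (x y z : T) : bool :=
  le x y && le y z || le z y && le y x.

Lemma between_dual (le : rel T) (x y z : T) :
  between (fun u v => le v u) x y z = between le x y z.
Proof. by rewrite /between orbC andbC [le z y && _]andbC. Qed.

Lemma minimum_lb (le : rel T) (x y : T) : total_order le ->
  le (minimum le x y) x /\ le (minimum le x y) y.
Proof.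
move=> [refl _ _ tot]; rewrite /minimum.
by case: ifP => xy; split=> //; have := tot x y; rewrite xy.
Qed.

Lemma maximum_ub (le : rel T) (x y : T) : total_order le ->
  le x (maximum le x y) /\ le y (maximum le x y).
Proof.
move=> [refl _ _ tot]; rewrite /maximum.
by case: ifP => xy; split=> //; have := tot x y; rewrite xy.
Qed.

End Between.

(** Betweenness leaves two possible directions for the images of a chain of
    three points.  The comparison of [f m] with [f M] settles the direction
    for [m], [x], [M], which gives [f x] below [f M]; that comparison in turn
    settles it for [x], [y], [M]. *)
Lemma between_isotone_on (S T : Type) (leS : rel S) (leT : rel T) (f : S -> T)
    (m x y M : S) :
    transitive leS -> transitive leT ->
    (forall u v w, between leS u v w -> between leT (f u) (f v) (f w)) ->
    leS m x -> leS x y -> leS y M -> leT (f m) (f M) ->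
  leT (f x) (f y).
Proof.
move=> trS trT fP mx xy yM fmM.
have fxM : leT (f x) (f M).
  have /fP : between leS m x M by rewrite /between mx (trS _ _ _ xy yM).
  by move=> /orP[/andP[]|/andP[_ xm]] //; exact: trT xm fmM.
have /fP : between leS x y M by rewrite /between xy yM.
by move=> /orP[/andP[]|/andP[My _]] //; exact: trT fxM My.
Qed.

Lemma between_monotone (S T : Type) (leS : rel S) (leT : rel T) (f : S -> T) :
    total_order leS -> total_order leT ->
  (forall x y z, between leS x y z -> between leT (f x) (f y) (f z)) <->
  monotone leS leT f.
Proof.
move=> oS [_ _ trT totT]; have [_ _ trS _] := oS; split=> [fP|]; last first.
  rewrite /between => -[] fM x y z /orP[] /andP[/fM h1 /fM h2];
    by rewrite h1 h2 ?orbT.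
have [|notiso] := pselect (isotone leS leT f); first by left.
right=> c d cd; apply: contrapT => notdc; apply: notiso => a b ab.
have [ma mc] := minimum_lb a c oS; have [bM dM] := maximum_ub b d oS.
have /orP[fmM|fMm] := totT (f (minimum leS a c)) (f (maximum leS b d)).
  exact: between_isotone_on trS trT fP ma ab bM fmM.
case: notdc.
(* [f] reverses the endpoints, so it is isotone on the interval for the dual
   of [leT]. *)
apply: (@between_isotone_on _ _ _ (fun u v => leT v u) f _ c d _ trS _ _
  mc cd dM fMm).
- by move=> v u w vu wv; exact: trT wv vu.
- by move=> u v w /fP; rewrite between_dual.
Qed.

Lemma chain_le_btw (A : medianAlgebraType) (le : rel A) (x y z : A) :
  chain_ordering le -> le x y -> le y z -> btw x y z.
Proof.
move=> [[refl anti tr _] medE] xy yz; rewrite /btw medE.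
rewrite /order_median /minimum xy (tr _ _ _ xy yz) /maximum refl.
case zy: (le z y); last by rewrite xy.
by rewrite (anti z y) ?zy // xy.
Qed.

(** From [btw] to the order: some point of the three is in the middle of the
    chain, and [btw_anti] identifies it with [y]. *)
Lemma chain_btw (A : medianAlgebraType) (le : rel A) (x y z : A) :
  chain_ordering le -> btw x y z <-> between le x y z.
Proof.
move=> ch; have le_btw u v w := @chain_le_btw A le u v w ch.
have [[refl anti tr tot] _] := ch; rewrite /between; split; last first.
  by case/orP=> /andP[h1 h2]; [exact: le_btw|apply: btwC; exact: le_btw].
move=> xyz.
have [/orP[xy|yx] /orP[yz|zy]] := (tot x y, tot y z).
- by rewrite xy yz.
- have /orP[xz|zx] := tot x z.
    by rewrite (btw_anti xyz (le_btw _ _ _ xz zy)) refl xz.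
  rewrite (btw_anti (btwC xyz) (le_btw _ _ _ zx xy)) refl zx orbT //.
- have /orP[xz|zx] := tot x z.
    by rewrite (btw_anti (btwC xyz) (btwC (le_btw _ _ _ yx xz))) refl xz.
  by rewrite (btw_anti xyz (btwC (le_btw _ _ _ yz zx))) refl zx orbT.
- by rewrite zy yx orbT.
Qed.

(** Conservativity of the source makes every median an instance of [btw] up to
    a permutation of the arguments, so preserving [btw] loses nothing. *)
Lemma median_hom_btw (A B : medianAlgebraType) (f : A -> B) :
  conservative A ->
  median_hom f <-> (forall x y z, btw x y z -> btw (f x) (f y) (f z)).
Proof.
move=> cA; split=> [fH x y z xyz | fP x y z]; first by rewrite /btw -fH xyz.
have [h|h|h] := btw_cases x y z cA; have := fP _ _ _ h; move: h => /[swap].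
- by rewrite /btw (medC12 x) (medC12 (f x)) => -> ->.
- by rewrite /btw => -> ->.
- by rewrite /btw (medC23 y x) (medC23 (f y)) => -> ->.
Qed.

Theorem proposition5 (A B : medianAlgebraType)
    (consA : conservative A) (consB : conservative B)
    (A5 : at_least_five A) (B5 : at_least_five B)
    (leA : rel A) (leB : rel B)
    (chainA : chain_ordering leA) (chainB : chain_ordering leB)
    (f : A -> B) :
  median_hom f <-> monotone leA leB f.
Proof.
rewrite (median_hom_btw f consA) -(between_monotone f chainA.1 chainB.1).
split=> fP x y z.
- by move=> /(chain_btw _ _ _ chainA)/fP/(chain_btw _ _ _ chainB).
- by move=> /(chain_btw _ _ _ chainA)/fP/(chain_btw _ _ _ chainB).
Qed.
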